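(* Let $X$ be a real or complex Banach space, let $U:\Delta_{+}\to\mathcal{B}(X)$ be an evolution operator and let $P:\mathbb{R}_{+}\to\mathcal{B}(X)$ be a projection valued function compatible with $U$. Suppose that $U$ has $P$-exponential growth, with constants $M\geq 1$, $\varepsilon\geq 0$, $\omega>0$, and that there exist $p>0$, $K\geq 1$, $\gamma>\varepsilon$ and $\delta\in[0,\gamma)$ such that $$\int_{0}^{\infty}e^{p\gamma|\tau-t|}\,\|G(\tau,t)x\|^{p}\,d\tau\leq K e^{p\delta t}\|x\|^{p}\quad\text{for all } t\geq 0 \text{ and } x\in X,$$ where $G$ is the Green function of $U$ and $P(\cdot)$. Then $U$ has a strong exponential dichotomy.
   Context: Let $X$ be a real or complex Banach space, $\mathcal{B}(X)$ the Banach algebra of bounded linear operators on $X$, and $\Delta_{+}=\{(t,s)\in\mathbb{R}_{+}\times\mathbb{R}_{+}: t\geq s\}$, where $\mathbb{R}_+=[0,\infty)$. Evolution operator: a map $U:\Delta_{+}\to\mathcal{B}(X)$ with $U(t,t)=Id$ for all $t\ge 0$; $U(t,s)U(s,t_0)=U(t,t_0)$ for all $t\geq s\geq t_0\ge 0$; and $(t,s)\mapsto U(t,s)x$ continuous on $\Delta_{+}$ for every $x\in X$. Projection valued function: a strongly continuous map $P:\mathbb{R}_{+}\to\mathcal{B}(X)$ with $P(t)^2=P(t)$ for all $t$; write $Q(t)=Id-P(t)$, so $\operatorname{Ker}P(t)=\operatorname{Range}Q(t)$. Compatibility: $P(\cdot)$ is compatible with $U$ if $P(t)U(t,s)=U(t,s)P(s)$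 for all $(t,s)\in\Delta_{+}$ and the restriction $U(t,s)|_{\operatorname{Ker}P(s)}:\operatorname{Ker}P(s)\to\operatorname{Ker}P(t)$ is an isomorphism for each $(t,s)\in\Delta_{+}$; its inverse is denoted $V(s,t):\operatorname{Ker}P(t)\to\operatorname{Ker}P(s)$. Strong exponential dichotomy: $U$ has a strong exponential dichotomy if there are a projection valued function $P$ compatible with $U$ and constants $N\geq1$, $\alpha\geq0$, $\beta>0$ with $\|U(t,s)P(s)\|\leq Ne^{\alpha s}e^{-\beta(t-s)}$ and $\|V(s,t)Q(t)\|\leq Ne^{\alpha s}e^{-\beta(t-s)}$ for all $(t,s)\in\Delta_{+}$. $P$-exponential growth: for $P$ compatible with $U$, $U$ has $P$-exponential growth (with constants $M,\varepsilon,\omega$) if there exist $M\geq1$, $\varepsilon\geq0$, $\omega>0$ with $\|U(t,s)P(s)\|\leq Me^{\varepsilon s}e^{\omega(t-s)}$ and $\|V(s,t)Q(t)\|\leq Me^{\varepsilon s}e^{\omega(t-s)}$ for all $(t,s)\in\Delta_{+}$. Green function of $U$ and a compatible $P(\cdot)$: $G(t,s)=U(t,s)P(s)$ for $t>s\geq0$, and $G(t,s)=-V(t,s)Q(s)$ for $s>t\geq0$. *)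

(* Defs.v *)
From HB Require Import structures.
From mathcomp Require Import all_boot all_order all_algebra.
From mathcomp Require Import complex.
From mathcomp Require Import all_classical all_reals all_analysis.

Set Implicit Arguments.
Unset Strict Implicit.
Unset Printing Implicit Defensive.

Import Order.TTheory GRing.Theory Num.Theory.
Import numFieldNormedType.Exports.

Local Open Scope classical_set_scope.
Local Open Scope ring_scope.

Variant scalar_kind := RealScalars | ComplexScalars.

Definition scalar_field (R : realType) (k : scalar_kind) : numFieldType :=
  match k with RealScalars => R | ComplexScalars => R[i] end.

(* The norm of a complex space is valued in R[i], on its nonnegative real
   half-line; [real_norm] brings it back to R. *)
Definition to_real (R : realType) (k : scalar_kind) : scalar_field R k -> R :=
  match k with RealScalars => fun a => a | ComplexScalars => @complex.Re R end.

Definition real_norm (R : realType) (k : scalar_kind)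
  (X : normedModType (scalar_field R k)) (x : X) : R := to_real `|x|.

Record bounded_operator (R : realType) (k : scalar_kind)
    (X : normedModType (scalar_field R k)) := BoundedOperator {
  operator_fun :> {linear X -> X} ;
  operator_bounded : exists C : R,
    forall x, real_norm (operator_fun x) <= C * real_norm x }.

Section dichotomy.
Context {R : realType} {k : scalar_kind}.
Context {X : completeNormedModType (scalar_field R k)}.
Implicit Types (U : R -> R -> bounded_operator X) (P : R -> bounded_operator X).

(* Extended-real valued, so that an unbounded map has norm +oo. *)
Definition opnorm (T : X -> X) : \bar R :=
  ereal_sup [set (real_norm (T x))%:E | x in [set x | real_norm x <= 1]].

(* Maps on R_+ and on Delta_+ are total maps on R and R * R of which only the
   values on these sets matter. *)
Definition Delta_plus : set (R * R) := [set ts | 0 <= ts.2 <= ts.1].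

Definition evolution_operator U : Prop :=
  [/\ forall t, 0 <= t -> U t t =1 id,
      forall t s t0, 0 <= t0 -> t0 <= s -> s <= t ->
        forall x, U t s (U s t0 x) = U t t0 x
    & forall x, {within Delta_plus, continuous (fun ts => U ts.1 ts.2 x)}].

Definition projection_valued P : Prop :=
  (forall t, 0 <= t -> forall x, P t (P t x) = P t x) /\
  (forall x, {within `[0, +oo[, continuous (fun t => P t x)}).

Definition Qproj P (t : R) (x : X) : X := x - P t x.

Definition Ker P (t : R) : set X := [set x | P t x = 0].

(* Vker U P s t, for 0 <= s <= t, is the inverse of the restriction of U t s to
   Ker P s -> Ker P t (extended by 0 outside the image of Ker P s). *)
Definition Vker U P (s t : R) : X -> X := 'pinv_(fun=> 0) (Ker P s) (U t s).

Definition compatible U P : Prop :=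
  forall t s, 0 <= s -> s <= t ->
    [/\ forall x, P t (U t s x) = U t s (P s x),
        set_bij (Ker P s) (Ker P t) (U t s)
      & {within Ker P t, continuous (Vker U P s t)}].

Definition P_exponential_growth U P (M eps omega : R) : Prop :=
  [/\ 1 <= M, 0 <= eps, 0 < omega
    & forall t s, 0 <= s -> s <= t ->
      (opnorm (U t s \o P s)
         <= (M * expR (eps * s) * expR (omega * (t - s)))%:E)%E /\
      (opnorm (Vker U P s t \o Qproj P t)
         <= (M * expR (eps * s) * expR (omega * (t - s)))%:E)%E].

Definition strong_exponential_dichotomy U : Prop :=
  exists P N alpha beta,
    [/\ projection_valued P, compatible U P,
        [/\ 1 <= N, 0 <= alpha & 0 < beta]
      & forall t s, 0 <= s -> s <= t ->
        (opnorm (U t s \o P s)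
           <= (N * expR (alpha * s) * expR (- beta * (t - s)))%:E)%E /\
        (opnorm (Vker U P s t \o Qproj P t)
           <= (N * expR (alpha * s) * expR (- beta * (t - s)))%:E)%E].

(* The Green function is not defined on the diagonal t = s; the value 0 chosen
   there does not affect the integral of tau |-> |G(tau, t) x|^p. *)
Definition Green U P (t s : R) (x : X) : X :=
  if s < t then U t s (P s x)
  else if t < s then - Vker U P t s (Qproj P s x)
  else 0.

End dichotomy.

(* Main.v *)
Require Import Defs.
From HB Require Import structures.
From mathcomp Require Import all_boot all_order all_algebra.
From mathcomp Require Import complex.
From mathcomp Require Import all_classical all_reals all_analysis.
From mathcomp Require Import ring lra.

(** The weighted integral condition controls the Green function only on average
    in tau; exponential growth turns this into a pointwise bound, at the price
    of a factor, because the norm at one end of a unit interval is bounded by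
    the norms inside it (Datko's argument).

    For the stable part let t >= s + 1 and t - 1 < tau < t. The cocycle
    identity U(t,s)P(s)x = U(t,tau)P(tau) U(tau,s)P(s)x and the growth bound give
      |U(t,s)P(s)x| <= M e^(eps t + omega) |G(tau,s)x|.
    Multiplying by e^(gamma |tau - s|) >= e^(gamma (t - 1 - s)), taking p-th
    powers and integrating over this unit interval yields
      |U(t,s)P(s)x| <= N e^(eps t + delta s - gamma (t - s)) |x|
    with N = M K^(1/p) e^(omega + gamma) ([stable_decay]). For the unstable part
    one averages over s < tau < s + 1 instead and uses V(s,t) = V(s,tau) V(tau,t), so
    that the growth factor is e^(eps s) and the exponent becomes
    eps s + delta t - gamma (t - s) ([unstable_decay]).

    Writing t = s + (t - s), the two exponents are
      (eps + delta) s - (gamma - eps) (t - s)  and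
      (eps + delta) s - (gamma - delta) (t - s),
    so the dichotomy holds with alpha = eps + delta and
    beta = min (gamma - eps, gamma - delta), which is positive. When t < s + 1
    the growth bounds alone suffice, since e^(beta (t - s)) is then bounded.

    The integral is bounded below straight from its definition: for a
    nonnegative function it is a supremum over the simple functions below it,
    so it dominates c mu(A) as soon as the function is at least c on A
    ([ge0_le_integral_cst]). This spares proving tau |-> |G(tau,t)x|
    measurable. *)

Set Implicit Arguments.
Unset Strict Implicit.
Unset Printing Implicit Defensive.

Import Order.TTheory GRing.Theory Num.Theory.
Import numFieldNormedType.Exports.

Local Open Scope classical_set_scope.
Local Open Scope ring_scope.

(** * Real-valued norms and operator norms *)

Section real_norm_theory.
Context {R : realType} {k : scalar_kind}.

(** Over the complex numbers the real part is multiplicative here because [a],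
    being nonnegative, has zero imaginary part. *)
Lemma to_realM (a b : scalar_field R k) : 0 <= a ->
  to_real (a * b) = to_real a * to_real b.
Proof.
case: k a b => //= -[a a'] [b b'] /=.
by rewrite lecE => /andP[/eqP /= -> _]; rewrite mul0r subr0.
Qed.

Lemma to_real_ge0 (a : scalar_field R k) : 0 <= a -> 0 <= to_real a.
Proof. by case: k a => //= -[a a']; rewrite lecE => /andP[]. Qed.

Lemma to_real1 : to_real (1 : scalar_field R k) = 1.
Proof. by case: k. Qed.

Context {X : normedModType (scalar_field R k)}.

Lemma real_norm_ge0 (x : X) : 0 <= real_norm x.
Proof. exact: to_real_ge0. Qed.

Lemma real_normZ (a : scalar_field R k) (x : X) :
  real_norm (a *: x) = to_real `|a| * real_norm x.
Proof. by rewrite /real_norm normrZ to_realM. Qed.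

Lemma real_norm0 : real_norm (0 : X) = 0.
Proof. by rewrite /real_norm normr0; case: k. Qed.

Lemma real_normN (x : X) : real_norm (- x) = real_norm x.
Proof. by rewrite /real_norm normrN. Qed.

End real_norm_theory.

Section opnorm_theory.
Context {R : realType} {k : scalar_kind}.
Context {X : completeNormedModType (scalar_field R k)}.

Lemma opnorm_le (T : X -> X) (C : R) : 0 <= C ->
  (forall x, real_norm (T x) <= C * real_norm x) -> (opnorm T <= C%:E)%E.
Proof.
move=> C0 h; apply: ge_ereal_sup => _ [x /= x1 <-]; rewrite lee_fin.
by apply: le_trans (h x) _; rewrite ler_piMr.
Qed.

(** Only homogeneity is asked of [T]: it is enough to normalize [x], and it
    spares proving that the inverse on the kernels is additive. *)
Lemma real_norm_le_opnorm (T : X -> X) (C : R) :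
  (forall a x, T (a *: x) = a *: T x) -> (opnorm T <= C%:E)%E ->
  forall x, real_norm (T x) <= C * real_norm x.
Proof.
move=> hT hC x; have [->|x0] := eqVneq x 0.
  by rewrite -(scale0r 0) hT !scale0r real_norm0 mulr0.
have nx : `|x| != 0 by rewrite normr_eq0.
have e : to_real `| (`|x|^-1) | * real_norm x = 1.
  by rewrite -real_normZ /real_norm normrZ normfV normr_id mulVf// to_real1.
have : ((real_norm (T (`|x|^-1 *: x)))%:E <= C%:E)%E.
  apply: le_trans hC; apply: ereal_sup_ubound.
  by exists (`|x|^-1 *: x) => //=; rewrite real_normZ e.
rewrite lee_fin hT real_normZ => {}h.
have := ler_wpM2r (real_norm_ge0 x) h.
by rewrite mulrAC e mul1r.
Qed.

End opnorm_theory.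

(** * From an integral bound to a pointwise bound *)

(** A Markov-type bound, valid for non-measurable [f] too: the simple function
    [c \1_A] is one of those whose integrals are at most the integral of [f]. *)
Lemma ge0_le_integral_cst d (T : measurableType d) (R : realType)
    (mu : {measure set T -> \bar R}) (D A : set T) (f : T -> \bar R) (c : R) :
  measurable A -> A `<=` D -> 0 <= c ->
  (forall x, D x -> (0 <= f x)%E) -> (forall x, A x -> (c%:E <= f x)%E) ->
  (c%:E * mu A <= \int[mu]_(x in D) f x)%E.
Proof.
move=> mA AD c0 f0 cf; rewrite ge0_integralE//.
pose h := scale_nnsfun (indic_nnsfun R mA) c0.
apply: ereal_sup_ubound; exists h.
- move=> x; rewrite /h /= measurable_realfun.mindicE patchE.
  have [xA|xA] := pselect (A x).
    by rewrite (mem_set xA) (mem_set (AD _ xA)) mulr1; exact: cf.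
  rewrite memNset// mulr0; case: ifPn => // /set_mem; exact: f0.
- by rewrite sintegralrM sintegral_indic.
Qed.

(** A unit interval has measure 1, so no constant depending on [p] appears. *)
Lemma le_of_integral_powR (R : realType) (p a c y B : R) (h : R -> R) :
  0 < p -> 0 <= a -> 0 < c -> 0 <= y -> 0 <= B ->
  (forall tau, a < tau < a + 1 -> y <= c * h tau) ->
  (\int[lebesgue_measure]_(tau in `[0%R, +oo[) ((h tau) `^ p)%:E
     <= (B `^ p)%:E)%E ->
  y <= c * B.
Proof.
move=> p0 a0 c0 y0 B0 yh hB.
rewrite mulrC -ler_pdivrMr// leNgt; apply/negP => By.
have z0 : 0 <= y / c by rewrite divr_ge0// ltW.
have : B `^ p < (y / c) `^ p by apply: gt0_ltr_powR.
apply/negP; rewrite -leNgt -lee_fin; apply: le_trans hB.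
have -> : (((y / c) `^ p)%:E =
    ((y / c) `^ p)%:E * (@lebesgue_measure R) `]a, (a + 1)%R[%classic)%E.
  rewrite lebesgue_measure_itv/= lte_fin ltrDl ltr01 -EFinB addrAC subrr add0r.
  by rewrite mule1.
apply: ge0_le_integral_cst => //.
- move=> t /=; rewrite !in_itv/= => /andP[/ltW ? _]; rewrite andbT.
  exact: le_trans a0 _.
- exact: powR_ge0.
- by move=> t _; rewrite lee_fin powR_ge0.
- move=> t /=; rewrite in_itv/= => /yh yt; rewrite lee_fin.
  have {}yt : y / c <= h t by rewrite ler_pdivrMr// mulrC.
  apply: ge0_ler_powR => //; first exact: ltW.
  by rewrite nnegrE (le_trans z0).
Qed.

(** * The inverse on the kernels *)

Section Green_estimates.
Context {R : realType} {k : scalar_kind}.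
Context {X : completeNormedModType (scalar_field R k)}.
Context (U : R -> R -> bounded_operator X) (P : R -> bounded_operator X).
Context (hU : evolution_operator U) (hP : projection_valued P).
Context (hUP : compatible U P).

Lemma Qproj_Ker t x : 0 <= t -> Ker P t (Qproj P t x).
Proof. by move=> t0; rewrite /Ker /Qproj /= linearB /= hP.1 ?subrr. Qed.

Lemma Qproj_id t x : Ker P t x -> Qproj P t x = x.
Proof. by rewrite /Ker /Qproj /= => ->; rewrite subr0. Qed.

Lemma Vker_Ker s t y : 0 <= s -> s <= t -> Ker P t y -> Ker P s (Vker U P s t y).
Proof.
move=> s0 st yK; have [_ b _] := hUP s0 st.
by have [+ _ _] := bijpinv_bij (fun=> 0) b; apply.
Qed.

Lemma VkerK s t y : 0 <= s -> s <= t -> Ker P t y -> U t s (Vker U P s t y) = y.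
Proof.
move=> s0 st yK; have [_ [_ _ sj] _] := hUP s0 st.
by apply: (surjpK _ sj); rewrite inE.
Qed.

Lemma Vker_eq s t z y : 0 <= s -> s <= t -> Ker P s z -> U t s z = y ->
  Vker U P s t y = z.
Proof.
move=> s0 st zK <-; have [_ [_ inj _] _] := hUP s0 st.
by apply: (pinvKV _ inj); rewrite inE.
Qed.

Lemma VkerZ s t a y : 0 <= s -> s <= t -> Ker P t y ->
  Vker U P s t (a *: y) = a *: Vker U P s t y.
Proof.
move=> s0 st yK; apply: Vker_eq => //; last by rewrite linearZ /= VkerK.
by rewrite /Ker /= linearZ /= Vker_Ker// scaler0.
Qed.

Lemma Vker_comp s r t y : 0 <= s -> s <= r -> r <= t -> Ker P t y ->
  Vker U P s r (Vker U P r t y) = Vker U P s t y.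
Proof.
move=> s0 sr rt yK; have r0 := le_trans s0 sr.
have wK : Ker P r (Vker U P r t y) by exact: Vker_Ker.
apply/esym; apply: Vker_eq => //; first exact: le_trans sr rt.
- exact: Vker_Ker.
- have [_ hcomp _] := hU.
  by rewrite -(hcomp t r s) // !VkerK.
Qed.

(** * Decay of the Green function *)

Context (M eps omega : R) (hgrowth : P_exponential_growth U P M eps omega).

Lemma growth_U s t x : 0 <= s -> s <= t ->
  real_norm (U t s (P s x))
    <= M * expR (eps * s + omega * (t - s)) * real_norm x.
Proof.
move=> s0 st; have [_ _ _ /(_ _ _ s0 st)[+ _]] := hgrowth.
rewrite -mulrA -expRD => h.
apply: (real_norm_le_opnorm (T := U t s \o P s)) h x => a z /=.
by rewrite !linearZ.
Qed.

Lemma growth_V s t x : 0 <= s -> s <= t ->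
  real_norm (Vker U P s t (Qproj P t x))
    <= M * expR (eps * s + omega * (t - s)) * real_norm x.
Proof.
move=> s0 st; have [_ _ _ /(_ _ _ s0 st)[_ +]] := hgrowth.
rewrite -mulrA -expRD => h.
apply: (real_norm_le_opnorm (T := Vker U P s t \o Qproj P t)) h x => a z /=.
have t0 := le_trans s0 st.
by rewrite -(VkerZ a s0 st (Qproj_Ker z t0)) /Qproj linearZ scalerBr.
Qed.

Context (p K gamma delta : R).
Context (p0 : 0 < p) (K1 : 1 <= K) (gamma0 : 0 <= gamma).
Context (hint : forall (t : R) (x : X), 0 <= t ->
  (\int[lebesgue_measure]_(tau in `[0%R, +oo[)
      (expR (p * gamma * `|tau - t|)
         * real_norm (Green U P tau t x) `^ p)%:E
     <= (K * expR (p * delta * t) * real_norm x `^ p)%:E)%E).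

(** The averaging step common to both parts; the weight e^(p gamma |tau - t|)
    is moved inside the p-th power to apply [le_of_integral_powR]. *)
Lemma le_of_Green_lb (a t c y : R) (x : X) :
  0 <= a -> 0 <= t -> 0 < c -> 0 <= y ->
  (forall tau, a < tau < a + 1 ->
     y <= c * (expR (gamma * `|tau - t|) * real_norm (Green U P tau t x))) ->
  y <= c * (K `^ p^-1 * expR (delta * t) * real_norm x).
Proof.
move=> a0 t0 c0 y0 hy.
have K0 : 0 <= K := le_trans ler01 K1.
apply: (le_of_integral_powR p0 a0 c0 y0 _ hy).
  by rewrite !mulr_ge0 ?real_norm_ge0 ?expR_ge0 ?powR_ge0.
rewrite !powRM ?mulr_ge0 ?real_norm_ge0 ?expR_ge0 ?powR_ge0//.
rewrite -powRrM mulVf ?gt_eqF// powRr1// -expRM.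
rewrite (_ : delta * t * p = p * delta * t); last by ring.
under eq_integral => tau _.
  rewrite powRM ?expR_ge0 ?real_norm_ge0// -expRM.
  rewrite (_ : _ * _ * p = p * gamma * `|tau - t|); last by ring.
  over.
exact: hint.
Qed.

Let N := M * K `^ p^-1 * expR (omega + gamma).

(** The average is taken next to [t], where [U t tau] costs at most
    M e^(eps t + omega). *)
Lemma stable_decay s t x : 0 <= s -> s + 1 <= t ->
  real_norm (U t s (P s x))
    <= N * expR (eps * t + delta * s - gamma * (t - s)) * real_norm x.
Proof.
move=> s0 st; have [M1 eps0 omega0 _] := hgrowth.
have M0 : 0 < M := lt_le_trans ltr01 M1.
rewrite (_ : N * _ * _ = M * expR (eps * t + omega - gamma * (t - 1 - s))
    * (K `^ p^-1 * expR (delta * s) * real_norm x)); last first.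
  have -> : expR (eps * t + delta * s - gamma * (t - s)) =
      expR (eps * t + omega - gamma * (t - 1 - s)) * expR (delta * s)
        / expR (omega + gamma).
    by rewrite -expRN -!expRD; congr expR; ring.
  by rewrite /N; field; rewrite gt_eqF// expR_gt0.
apply: (@le_of_Green_lb (t - 1)) => //; first by lra.
- by rewrite mulr_gt0// expR_gt0.
- exact: real_norm_ge0.
move=> tau /andP[tau1 tau2].
have st' : s < tau by lra.
have r0 : 0 <= tau by lra.
rewrite /Green st'.
have [_ hcomp _] := hU; have [hcomm _ _] := hUP s0 (ltW st').
rewrite -(hcomp t tau s)//; [|by lra..].
(* A factor P tau is needed in front of the orbit to apply the growth bound. *)
rewrite -[in leLHS](hP.1 s s0) -hcomm.
apply: le_trans (growth_U _ r0 _) _; first by lra.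
rewrite mulrA ler_wpM2r ?real_norm_ge0//.
rewrite -mulrA ler_pM2l// -expRD ler_expR gtr0_norm ?subr_gt0//.
have : 0 <= eps * (t - tau) by rewrite mulr_ge0//; lra.
have : 0 <= omega * (1 - (t - tau)) by rewrite mulr_ge0//; lra.
have : 0 <= gamma * (tau - (t - 1)) by rewrite mulr_ge0//; lra.
lra.
Qed.

(** The average is taken next to [s], where [Vker U P s tau] costs at most
    M e^(eps s + omega); this keeps [eps] attached to [s] and leaves the factor
    e^(delta t), absorbed by gamma > delta. *)
Lemma unstable_decay s t x : 0 <= s -> s + 1 <= t ->
  real_norm (Vker U P s t (Qproj P t x))
    <= N * expR (eps * s + delta * t - gamma * (t - s)) * real_norm x.
Proof.
move=> s0 st; have [M1 eps0 omega0 _] := hgrowth.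
have M0 : 0 < M := lt_le_trans ltr01 M1.
rewrite (_ : N * _ * _ = M * expR (eps * s + omega - gamma * (t - 1 - s))
    * (K `^ p^-1 * expR (delta * t) * real_norm x)); last first.
  have -> : expR (eps * s + delta * t - gamma * (t - s)) =
      expR (eps * s + omega - gamma * (t - 1 - s)) * expR (delta * t)
        / expR (omega + gamma).
    by rewrite -expRN -!expRD; congr expR; ring.
  by rewrite /N; field; rewrite gt_eqF// expR_gt0.
apply: (@le_of_Green_lb s) => //; first by lra.
- by rewrite mulr_gt0// expR_gt0.
- exact: real_norm_ge0.
move=> tau /andP[tau1 tau2].
have rt : tau < t by lra.
have r0 : 0 <= tau by lra.
have t0 : 0 <= t by lra.
have QK := Qproj_Ker x t0.
rewrite /Green ltNge (ltW rt) /= rt real_normN.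
rewrite -(@Vker_comp s tau t)//; [|by lra..].
rewrite -(Qproj_id (Vker_Ker r0 (ltW rt) QK)).
apply: le_trans (growth_V _ s0 _) _; first by lra.
rewrite (Qproj_id (Vker_Ker r0 (ltW rt) QK)).
rewrite mulrA ler_wpM2r ?real_norm_ge0//.
rewrite -mulrA ler_pM2l// -expRD ler_expR distrC gtr0_norm ?subr_gt0//.
have : 0 <= omega * (1 - (tau - s)) by rewrite mulr_ge0//; lra.
have : 0 <= gamma * (s + 1 - tau) by rewrite mulr_ge0//; lra.
lra.
Qed.

End Green_estimates.

Theorem theorem3p4 (R : realType) (k : scalar_kind)
    (X : completeNormedModType (scalar_field R k))
    (U : R -> R -> bounded_operator X) (P : R -> bounded_operator X)
    (hU : evolution_operator U)
    (hP : projection_valued P)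
    (hUP : compatible U P)
    (M eps omega : R)
    (hgrowth : P_exponential_growth U P M eps omega)
    (hint : exists p K gamma delta : R,
      [/\ 0 < p, 1 <= K, eps < gamma, 0 <= delta < gamma
        & forall (t : R) (x : X), 0 <= t ->
          (\int[lebesgue_measure]_(tau in `[0%R, +oo[)
              (expR (p * gamma * `|tau - t|)
                 * real_norm (Green U P tau t x) `^ p)%:E
             <= (K * expR (p * delta * t) * real_norm x `^ p)%:E)%E]) :
  strong_exponential_dichotomy U.
Proof.
have [p [K [gamma [delta [p0 K1 eg /andP[d0 dg] hG]]]]] := hint.
have [M1 e0 w0 _] := hgrowth.
have g0 : 0 <= gamma by lra.
have L1 : 1 <= K `^ p^-1.
  have <- : 1 `^ p^-1 = 1 :> R by rewrite powR1.
  apply: ge0_ler_powR => //.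
  - by rewrite invr_ge0 ltW.
  - by rewrite nnegrE.
  - by rewrite nnegrE (le_trans ler01).
have N1 : 1 <= M * K `^ p^-1 * expR (omega + gamma).
  apply: mulr_ege1; first exact: mulr_ege1.
  by rewrite -expR0 ler_expR; lra.
set N := M * _ * _ in N1.
have [b0 bge bgd] : [/\ 0 < Num.min (gamma - eps) (gamma - delta),
    Num.min (gamma - eps) (gamma - delta) <= gamma - eps
  & Num.min (gamma - eps) (gamma - delta) <= gamma - delta].
  by rewrite lt_min !subr_gt0 eg dg !ge_min !lexx orbT.
set beta := Num.min _ _ in b0 bge bgd.
exists P, N, (eps + delta), beta; split => //; first by split=> //; lra.
move=> t s s0 st.
rewrite -mulrA -expRD.
(* Either t < s + 1 and the growth bound is already good enough, or the decay
   estimates apply. *)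
have ML : M * expR (eps * s + omega * (t - s))
    <= N * expR ((eps + delta) * s + - beta * (t - s)) \/ s + 1 <= t.
  have [|ts] := leP (s + 1) t; [by right|left].
  rewrite /N -(mulrA _ _ (expR _)) -expRD; apply: ler_pM.
  - by lra.
  - exact: expR_ge0.
  - by rewrite ler_peMr//; lra.
  - by rewrite ler_expR; nra.
have C0 : 0 <= N * expR ((eps + delta) * s + - beta * (t - s)).
  by rewrite mulr_ge0 ?expR_ge0//; lra.
have N0 : 0 < N by lra.
split; apply: opnorm_le => // x /=; case: ML => [ML|ts].
- apply: le_trans (growth_U hgrowth _ s0 st) _.
  by rewrite ler_wpM2r ?real_norm_ge0.
- apply: le_trans (stable_decay hU hP hUP hgrowth p0 K1 g0 hG _ s0 ts) _.
  by rewrite ler_wpM2r ?real_norm_ge0// ler_pM2l// ler_expR; nra.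
- apply: le_trans (growth_V hP hUP hgrowth _ s0 st) _.
  by rewrite ler_wpM2r ?real_norm_ge0.
- apply: le_trans (unstable_decay hU hP hUP hgrowth p0 K1 g0 hG _ s0 ts) _.
  by rewrite ler_wpM2r ?real_norm_ge0// ler_pM2l// ler_expR; nra.
Qed.
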